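(* Let $x\in\mathbb{C}$ with $\mathrm{Re}(x)>0$, let $k,p$ be positive real numbers, and let $n\in\mathbb{N}$, $n\ge 1$. Then $$ {}_{p}(x)_{n,k}=\sum_{s=0}^{n-1}p^{n}\,e_{s}^{n-1}(1,2,\dots,n-1)\left(\frac{x}{k}\right)^{n-s}.$$
   Context: The p-k Pochhammer symbol is ${}_{p}(x)_{n,k}=\left(\frac{xp}{k}\right)\left(\frac{xp}{k}+p\right)\left(\frac{xp}{k}+2p\right)\cdots\left(\frac{xp}{k}+(n-1)p\right)$. For integers $0\le s\le m$, $e^{m}_{s}(x_1,\dots,x_m)=\sum_{1\le i_1<i_2<\dots<i_s\le m}x_{i_1}\cdots x_{i_s}$ is the $s$-th elementary symmetric function in the $m$ variables $x_1,\dots,x_m$, with $e^m_0=1$ (including $m=0$). *)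

(* Defs.v *)
From HB Require Import structures.
From mathcomp Require Import all_boot all_order all_algebra.
From mathcomp Require Import complex reals.
From mathcomp Require Import mpoly.

Set Implicit Arguments.
Unset Strict Implicit.
Unset Printing Implicit Defensive.

Import GRing.Theory Num.Theory.
Local Open Scope ring_scope.
Local Open Scope complex_scope.

Definition pk_pochhammer (R : realType) (p : R) (x : R[i]) (n : nat) (k : R)
  : R[i] :=
  \prod_(j < n) (x * p%:C / k%:C + j%:R * p%:C).

(* The sum in [mesym] ranges over the subsets of 'I_m of cardinal s, i.e. over
   the index sets {i_1 < ... < i_s}; variables are numbered from 0. *)
Definition elem_sym (R : realType) (m s : nat) (v : 'I_m -> R[i]) : R[i] :=
  (mesym m R[i] s).@[v].
Arguments elem_sym {R} m s v.

(* Main.v *)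
Require Import Defs.
From HB Require Import structures.
From mathcomp Require Import all_boot all_order all_algebra.
From mathcomp Require Import complex reals.
From mathcomp Require Import mpoly.

Import GRing.Theory Num.Theory.
Local Open Scope ring_scope.
Local Open Scope complex_scope.

(** Each factor of the symbol is [p * (x/k + j)], so [p ^+ n] comes out. The factor [j = 0] is [x/k]
    itself; the others form the product of [x/k + j] for [1 <= j <= n-1], which Vieta's expansion
    [prod_addr_mesym] turns into a polynomial in [x/k] with coefficients [e_s(1, ..., n-1)]. The
    spare [x/k] raises every exponent by one. *)

(** Expanding means choosing the set [J] of factors that contribute [v i]; grouping the choices by
    [#|J|] yields the elementary symmetric functions. *)
Lemma prod_addr_mesym (A : comNzRingType) (m : nat) (y : A) (v : 'I_m -> A) :
  \prod_(i < m) (y + v i) =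
    \sum_(s < m.+1) (mesym m A s).@[v] * y ^+ (m - s).
Proof.
have cardS (J : {set 'I_m}) : (#|J| < m.+1)%N.
  by rewrite ltnS -[leqRHS]card_ord max_card.
under eq_bigr do rewrite addrC.
rewrite bigA_distr.
(* By [cardS], [inord] never falls back to its default value here. *)
rewrite (partition_big (fun J : {set 'I_m} => inord #|J| : 'I_m.+1) xpredT) //=.
apply: eq_bigr => s _; rewrite /mesym raddf_sum mulr_suml /=.
apply: eq_big => [J | J /eqP Js]; first by rewrite -val_eqE /= inordK.
have cJ : #|J| = s by rewrite -Js inordK.
rewrite (bigID (mem J)) /= rmorph_prod /=; congr (_ * _).
  by apply: eq_bigr => i iJ; rewrite iJ mevalXU.
under eq_bigr => i /negbTE-> do [].
(* The exponent [m - s] of [y] is the size of the complement of [J]. *)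
by rewrite prodr_const -cJ -(addKn #|J| #|[predC J]|) cardC card_ord.
Qed.

Theorem theorem2p1 (R : realType) (x : R[i]) (k p : R) (n : nat)
    (hx : 0 < complex.Re x) (hk : 0 < k) (hp : 0 < p) (hn : (1 <= n)%N) :
  pk_pochhammer p x n k =
    \sum_(0 <= s < n)
       p%:C ^+ n * elem_sym n.-1 s (fun i : 'I_(n.-1) => (i.+1)%:R)
       * (x / k%:C) ^+ (n - s).
Proof.
case: n hn => // m _; rewrite /pk_pochhammer /elem_sym /=.
under eq_bigr do rewrite mulrAC -mulrDl mulrC.
(* Splitting off [j = 0] leaves the indices shifted by one, hence the variables [i.+1]. *)
rewrite big_split prodr_const card_ord big_ord_recl addr0 /=.
rewrite prod_addr_mesym big_mkord !mulr_sumr.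
apply: eq_bigr => s _.
(* Since [s <= m], truncated subtraction gives [m.+1 - s = (m - s).+1]. *)
by rewrite subSn -1?ltnS // (exprS (x / _)) -[RHS]mulrA; congr (_ * _); rewrite [RHS]mulrCA.
Qed.
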